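(* Let $J:\mathbb{R}^{n+1}\to\mathbb{R}$ be a function of $(x,t)\in\mathbb{R}^n\times\mathbb{R}$ such that: $J\ge 0$; $J\in L^1(\mathbb{R}^{n+1})$ with $\iint_{\mathbb{R}^{n+1}}J(x,t)\,dx\,dt=1$; $J$ has compact support in $\mathbb{R}^{n+1}$; and for each $t$ the function $x\mapsto J(x,t)$ is radial on $\mathbb{R}^n$. For $r>0$ set $J_r(x,t)=\frac{1}{r^{n+2}}J\left(\frac{x}{r},\frac{t}{r^2}\right)$. Then, for each $\varphi$ in the Schwartz class of $\mathbb{R}^{n+1}$, $$\lim_{r\to 0}\frac{1}{r^2}\left(J_r-\delta\right)\ast\varphi=\mu\frac{\partial\varphi}{\partial t}+\nu\,\triangle\varphi$$ uniformly on $\mathbb{R}^{n+1}$, where $\mu=-\iint_{\mathbb{R}^{n+1}} t\,J(x,t)\,dx\,dt$ and $\nu=\frac{1}{2n}\iint_{\mathbb{R}^{n+1}}|x|^2J(x,t)\,dx\,dt$.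
   Context: Points of $\mathbb{R}^{n+1}$ are written $(x,t)$ with $x\in\mathbb{R}^n$ (space) and $t\in\mathbb{R}$ (time). The symbol $\delta$ is the Dirac delta at the origin of $\mathbb{R}^{n+1}$, $\ast$ is convolution in $\mathbb{R}^{n+1}$, so $\left[(J_r-\delta)\ast\varphi\right](x,t)=\iint_{\mathbb{R}^{n+1}}J_r(x-y,t-s)\varphi(y,s)\,dy\,ds-\varphi(x,t)$. The operator $\triangle$ is the Laplacian in the space variable $x\in\mathbb{R}^n$ only. *)

(* Defs.v *)
From HB Require Import structures.
From mathcomp Require Import all_boot all_order all_algebra.
From mathcomp Require Import complex.
From mathcomp Require Import all_classical all_reals all_analysis.

Set Implicit Arguments.
Unset Strict Implicit.
Unset Printing Implicit Defensive.

Import Order.TTheory GRing.Theory Num.Theory.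
Import numFieldNormedType.Exports.

Local Open Scope classical_set_scope.
Local Open Scope ring_scope.

(* Rcomplex R is R[i] as a real vector space with the modulus as norm; the
   instances below add the induced topology, making it a normedModType R, so
   that complex-valued functions of real variables have derivatives. *)
Lemma Rcomplex_normrZ (R : realType) (l : R) (x : Rcomplex R) :
  `|l *: x| = `|l| * `|x|.
Proof.
case: x => a b; rewrite /Num.norm /= !exprMn -mulrDr sqrtrM ?sqr_ge0//.
by rewrite sqrtr_sqr.
Qed.

HB.instance Definition _ (R : realType) :=
  PseudoMetric.copy (Rcomplex R) (pseudoMetric_normed (Rcomplex R)).
HB.instance Definition _ (R : realType) := isPointed.Build (Rcomplex R) 0.
HB.instance Definition _ (R : realType) :=
  NormedZmod_PseudoMetric_eq.Build R (Rcomplex R) erefl.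
HB.instance Definition _ (R : realType) :=
  PseudoMetricNormedZmod_Lmodule_isNormedModule.Build R (Rcomplex R)
    (@Rcomplex_normrZ R).

Notation spacetime R n := ('rV[R]_n * R)%type.

Section lebesgue_spacetime.
Variables (R : realType) (n : nat).
Local Notation E := (spacetime R n).
Implicit Types a b z : E.

Definition cbox a b : set E :=
  [set z : E | (forall i, a.1 0 i <= z.1 0 i <= b.1 0 i) /\ a.2 <= z.2 <= b.2].

(* The truncation gives volume 0 when some side is reversed (empty box). *)
Definition box_volume a b : R :=
  (\prod_(i < n) Num.max 0 (b.1 0 i - a.1 0 i)) * Num.max 0 (b.2 - a.2).

Local Open Scope ereal_scope.

Definition box_cover (A : set E) : set (nat -> E * E) :=
  [set C | A `<=` \bigcup_k cbox (C k).1 (C k).2].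

(* Lebesgue outer measure on R^n x R: countable covers by closed boxes. *)
Definition lebesgue_outer (A : set E) : \bar R :=
  ereal_inf [set \sum_(k <oo) (box_volume (C k).1 (C k).2)%:E
            | C in box_cover A].

Lemma box_volume_ge0 a b : (0 <= box_volume a b)%R.
Proof.
by rewrite mulr_ge0 ?prodr_ge0// => *; rewrite le_max lexx.
Qed.

Let vol (c : E * E) : \bar R := (box_volume c.1 c.2)%:E.

Let vol_ge0 c : 0 <= vol c.
Proof. by rewrite lee_fin box_volume_ge0. Qed.

Lemma lebesgue_outer_ge0 A : 0 <= lebesgue_outer A.
Proof.
by apply: le_ereal_inf_tmp => x [C _ <-{x}]; apply: nneseries_ge0 => *;
  exact: vol_ge0.
Qed.

Lemma le_lebesgue_outer : {homo lebesgue_outer : A B / A `<=` B >-> A <= B}.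
Proof.
move=> A B AB; apply/ereal_inf_le_tmp => x [C BC <-{x}].
by exists C => //; exact: subset_trans AB BC.
Qed.

Lemma lebesgue_outer0 : lebesgue_outer set0 = 0.
Proof.
apply/eqP; rewrite eq_le lebesgue_outer_ge0 andbT.
apply: ereal_inf_lbound; exists (fun=> (0%R, 0%R)); first by [].
apply: eseries0 => k _ _; congr (_%:E).
by rewrite /box_volume /= subrr maxxx mulr0.
Qed.

Lemma lebesgue_outer_sigma_subadditive : sigma_subadditive lebesgue_outer.
Proof.
move=> A; have [[i ioo]|] := pselect (exists i, lebesgue_outer (A i) = +oo).
  rewrite (eseries_pinfty _ _ ioo) ?leey// => k _.
  by rewrite -ltNye (lt_le_trans _ (lebesgue_outer_ge0 _)).
rewrite -forallNE => Aoo.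
suff add2e (e : {posnum R}) : lebesgue_outer (\bigcup_k A k) <=
    \sum_(i <oo) lebesgue_outer (A i) + e%:num%:E.
  by apply/lee_addgt0Pr => _/posnumP[].
rewrite (le_trans _ (epsilon_trick _ _ _))//; last first.
  by move=> k; exact: lebesgue_outer_ge0.
pose P k (B : nat -> E * E) := box_cover (A k) B /\
  \sum_(j <oo) vol (B j) <= lebesgue_outer (A k) + (e%:num / (2 ^ k.+1)%:R)%:E.
have [G PG] : {G : nat -> nat -> E * E & forall k, P k (G k)}.
  apply: (@choice _ _ P) => k; rewrite /P /lebesgue_outer.
  set S := (X in ereal_inf X); move infS : (ereal_inf S) => iS.
  case: iS infS => [r Sr|Soo|Soo].
  - have en1 : (0 < e%:num / (2 ^ k.+1)%:R)%R by [].
    have /(lb_ereal_inf_adherent en1) : ereal_inf S \is a fin_num by rewrite Sr.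
    move=> [x [B AnB muBx] xS].
    by exists B; split => //; rewrite muBx -Sr; exact/ltW.
  - by have := Aoo k; rewrite /lebesgue_outer Soo.
  - suff : lbound S 0 by move/le_ereal_inf_tmp; rewrite Soo.
    by move=> /= _ [B AnB <-]; apply: nneseries_ge0 => *; exact: vol_ge0.
have volG_ge0 x : 0 <= (vol \o uncurry G) x by exact: vol_ge0.
apply: (@le_trans _ _ (\esum_(i in setT) (vol \o uncurry G) i)).
  rewrite /lebesgue_outer; apply: ereal_inf_lbound => /=.
  have /card_esym/ppcard_eqP[f] := card_nat2.
  exists (uncurry G \o f).
    move=> z [i _ /((PG i).1)[j _ Gz]].
    by exists (f^-1%FUN (i, j)) => //=; rewrite invK ?inE.
  rewrite -(esum_pred_image (vol \o uncurry G) _ xpredT) ?[fun=> _]set_true//.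
  by rewrite image_eq.
rewrite (_ : esum _ _ = \sum_(i <oo) \sum_(j <oo ) vol (G i j)); last first.
  pose J : nat -> set (nat * nat) := fun i => [set (i, j) | j in setT].
  rewrite (_ : setT = \bigcup_k J k); last first.
    by rewrite predeqE => -[a b]; split => // _; exists a => //; exists b.
  rewrite esum_bigcupT /=; last 2 first.
    - apply/trivIsetP => i j _ _ ij.
      rewrite predeqE => -[k m] /=; split => //= -[] [_] _ [<-{k} _].
      by move=> [m' _] [] /esym/eqP; rewrite (negbTE ij).
    - by move=> /= *; exact: vol_ge0.
  rewrite -(image_id [set: nat]) -fun_true esum_pred_image//; last first.
    by move=> k _; exact: esum_ge0.
  apply: eq_eseriesr => /= j _.
  rewrite -(esum_pred_image (vol \o uncurry G) (pair j) predT)//=; last first.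
    by move=> ? ? _ _; exact: (@can_inj _ _ _ snd).
  by congr esum; rewrite predeqE => -[a b]; split; move=> [i _ <-]; exists i.
apply: lee_lim.
- apply: is_cvg_nneseries => k *.
  by apply: nneseries_ge0 => m *; exact: vol_ge0.
- apply: is_cvg_nneseries => k *; apply: adde_ge0 => //.
  exact: lebesgue_outer_ge0.
- by near=> k; apply: lee_sum => i _; exact: (PG i).2.
Unshelve. all: by end_near. Qed.

HB.instance Definition _ := isOuterMeasure.Build R E lebesgue_outer
  lebesgue_outer0 lebesgue_outer_ge0 le_lebesgue_outer
  lebesgue_outer_sigma_subadditive.

(* The carrier is E with the sigma-algebra of Lebesgue measurable sets, i.e.,
   the Caratheodory measurable sets of the outer measure. *)
Definition lebesgue_spacetime :
    set (caratheodory_type lebesgue_outer) -> \bar R :=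
  lebesgue_outer.

HB.instance Definition _ := isMeasure.Build _ _ _ lebesgue_spacetime
  (@caratheodory_measure0 R E lebesgue_outer)
  (@caratheodory_measure_ge0 R E lebesgue_outer)
  (@caratheodory_measure_sigma_additive R E lebesgue_outer).

End lebesgue_spacetime.

Arguments lebesgue_spacetime : clear implicits.

Section calculus.
Variables (R : realType) (n : nat).
Local Notation E := (spacetime R n).

(* The Euclidean norm; the norm that 'rV[R]_n carries in the library is the
   maximum norm. *)
Definition enorm (x : 'rV[R]_n) : R := Num.sqrt (\sum_i x 0 i ^+ 2).

Definition radial (f : 'rV[R]_n -> R) : Prop :=
  exists g : R -> R, forall x, f x = g (enorm x).

(* The coordinates of E are indexed by option 'I_n, None being time. *)
Definition coord_vec (k : option 'I_n) : E :=
  if k is Some i then (delta_mx 0 i, 0) else (0, 1).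

Definition coord_val (z : E) (k : option 'I_n) : R :=
  if k is Some i then z.1 0 i else z.2.

Definition partial (k : option 'I_n) (phi : E -> Rcomplex R) : E -> Rcomplex R :=
  'D_(coord_vec k) phi.

(* Mixed partial derivatives of every order; s lists the differentiation
   coordinates, so each multi-index occurs as some s. *)
Definition iter_partial (s : seq (option 'I_n)) (phi : E -> Rcomplex R) :
    E -> Rcomplex R :=
  foldr partial phi s.

(* C^infty: the function and all its iterated partial derivatives are
   differentiable, hence continuous. *)
Definition smooth (phi : E -> Rcomplex R) : Prop :=
  forall s z, differentiable (iter_partial s phi) z.

Definition schwartz (phi : E -> Rcomplex R) : Prop :=
  smooth phi /\
  forall (alpha : option 'I_n -> nat) (s : seq (option 'I_n)),
    exists M : R, forall z,
      `| (\prod_k coord_val z k ^+ alpha k) *: iter_partial s phi z | <= M.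

Definition laplacian (phi : E -> Rcomplex R) (z : E) : Rcomplex R :=
  \sum_(i < n) partial (Some i) (partial (Some i) phi) z.

Definition Cintegral (f : E -> Rcomplex R) : Rcomplex R :=
  Complex (\int[lebesgue_spacetime R n]_w complex.Re (f w))
          (\int[lebesgue_spacetime R n]_w complex.Im (f w)).

Definition convolution (K : E -> R) (phi : E -> Rcomplex R) (z : E) :
    Rcomplex R :=
  Cintegral (fun w => K (z - w) *: phi w).

Definition convolution_sub_delta (K : E -> R) (phi : E -> Rcomplex R) (z : E) :
    Rcomplex R :=
  convolution K phi z - phi z.

Definition parabolic_dilation (J : E -> R) (r : R) (z : E) : R :=
  (r ^+ (n + 2))^-1 * J (r^-1 *: z.1, z.2 / r ^+ 2).

Definition closed_support (J : E -> R) : set E := closure [set z | J z != 0].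

End calculus.

(* Main.v *)
Require Import Defs.
From HB Require Import structures.
From mathcomp Require Import all_boot all_order all_algebra.
From mathcomp Require Import complex.
From mathcomp Require Import all_classical all_reals all_analysis.
From mathcomp Require Import fingroup perm measurable_realfun.
From mathcomp Require Import ring lra.
Import Order.TTheory GRing.Theory Num.Theory.
Import numFieldNormedType.Exports.
Set Implicit Arguments.
Unset Strict Implicit.
Unset Printing Implicit Defensive.
Local Open Scope classical_set_scope.
Local Open Scope ring_scope.

(** Substituting w = z - D y with D y = (r y_x, r^2 y_t) turns the convolution
  of the dilated kernel with phi at z into the average of phi (z - D y) against
  J (y) dy.  Taylor's formula at z, to second order, leaves an error of order
  r^3, uniform in z because the third derivatives of phi are bounded and y
  ranges over the bounded support of J.  Averaging the Taylor polynomial only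
  involves the moments of J.  As J is radial in space, it is invariant under
  the reflections x_i -> - x_i and the exchanges of x_i and x_j; the former
  kill the first moments in space and all the mixed second moments, the latter
  make the n pure second moments in space equal, hence each is 1/n times the
  integral of |x|^2 J.  What survives is
  phi + r^2 (mu d_t phi + nu Laplacian phi) + O(r^3) + O(r^4), the last term
  coming from the second moment in time.

  Both the substitution and the two symmetries are affine maps whose linear
  part is a monomial matrix (a permutation of the coordinates followed by a
  diagonal scaling).  Such maps send boxes to boxes, so their effect on
  Lebesgue measure is read off directly from the covers by boxes that define
  the outer measure (outer_preimage_monomial), and the change of variables
  follows (integral_monomial_map).

  The measurability of phi is bypassed: the integrand of the convolution is
  squeezed between two integrable functions, the Taylor polynomial plus or
  minus the error bound, both times the kernel, and the integral is monotone
  on all functions (Rintegral_sandwich).  Besides J, the integrable functions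
  involved are polynomials in the coordinates, so that their measurability
  comes down to that of half-spaces (caratheodory_halfspace).

  Space and time coordinates are handled alike by indexing them with
  option 'I_n, None standing for time.  The complex-valued phi is treated
  through its real and imaginary parts: each provides a family of real
  functions, indexed by lists of coordinates and closed under partial
  derivatives, to which the real estimate real_generator_error applies. *)

(** * Boxes and half-spaces in coordinates *)

Section coordinates.
Variables (R : realType) (n : nat).
Local Notation E := (spacetime R n).

Definition of_coords (u : option 'I_n -> R) : E :=
  (\row_i u (Some i), u None).

Lemma coord_of_coords u : coord_val (of_coords u) =1 u.
Proof. by case=> [i|] //=; rewrite mxE. Qed.

Lemma of_coords_coord z : of_coords (coord_val z) = z.
Proof.
by case: z => x t; congr pair; apply/rowP => i; rewrite mxE.
Qed.

Lemma coord_inj (z w : E) : coord_val z =1 coord_val w -> z = w.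
Proof.
by move=> zw; rewrite -[z]of_coords_coord -[w]of_coords_coord (funext zw).
Qed.

Lemma coord_valB (z w : E) k :
  coord_val (z - w) k = coord_val z k - coord_val w k.
Proof. by case: k => [i|] //=; rewrite !mxE. Qed.

Lemma big_option (V : Type) (idx : V) (op : Monoid.com_law idx)
    (F : option 'I_n -> V) :
  \big[op/idx]_k F k = op (\big[op/idx]_(i < n) F (Some i)) (F None).
Proof.
rewrite (bigD1 None)//= Monoid.mulmC; congr (op _ _).
rewrite (reindex_omap Some id) //=; last by case.
by apply: eq_bigl => i; rewrite eqxx.
Qed.

Lemma cboxP (a b z : E) : cbox a b z <->
  forall k, coord_val a k <= coord_val z k <= coord_val b k.
Proof.
split=> [[zx zt] [i|] /=|zk]; [exact: zx|exact: zt|].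
by split=> [i|]; [exact: (zk (Some i))|exact: (zk None)].
Qed.

Lemma box_volumeE (a b : E) :
  box_volume a b = \prod_k Num.max 0 (coord_val b k - coord_val a k).
Proof. by rewrite big_option. Qed.

Lemma le_outer_box_cover (B : set E) (C : nat -> E * E) :
  B `<=` \bigcup_k cbox (C k).1 (C k).2 ->
  (lebesgue_outer B <= \sum_(k <oo) (box_volume (C k).1 (C k).2)%:E)%E.
Proof. by move=> BC; apply: ereal_inf_lbound; exists C. Qed.

Definition set_coord (z : E) k0 (x : R) : E :=
  of_coords (fun k => if k == k0 then x else coord_val z k).

Lemma interval_length_split (a b x : R) :
  Num.max 0 (Num.min b x - a) + Num.max 0 (b - Num.max a x) = Num.max 0 (b - a).
Proof.
have [bx|xb] := leP b x; have [ax|xa] := leP a x.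
- by rewrite [X in _ + X]max_l ?addr0// subr_le0.
- have ba : b - a <= 0 by lra.
  by rewrite (max_l ba) addr0.
- rewrite (@max_r _ _ 0 (x - a)) ?subr_ge0//.
  rewrite (@max_r _ _ 0 (b - x)) ?subr_ge0 ?(ltW xb)//.
  rewrite (@max_r _ _ 0 (b - a)); lra.
- have xa' : x - a <= 0 by lra.
  by rewrite (max_l xa') add0r.
Qed.

(** Cutting a box by a hyperplane orthogonal to an axis gives two boxes whose
  volumes add up; the truncation at 0 in the volume absorbs the case of an empty
  piece. *)
Lemma box_volume_split (a b : E) k (x : R) :
  box_volume a (set_coord b k (Num.min (coord_val b k) x)) +
  box_volume (set_coord a k (Num.max (coord_val a k) x)) b = box_volume a b.
Proof.
rewrite !box_volumeE !(@bigD1 _ _ _ _ k xpredT)//= !coord_of_coords eqxx.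
under eq_bigr => j /negbTE jk do rewrite coord_of_coords jk.
under [X in _ + _ * X]eq_bigr => j /negbTE jk do rewrite coord_of_coords jk.
rewrite -mulrDl; congr (_ * _).
exact: interval_length_split.
Qed.

(** Every box of a cover of X splits along the boundary of the half-space, which
  turns the cover into covers of the two pieces of X of the same total volume. *)
Lemma caratheodory_halfspace k (x : R) :
  (@lebesgue_outer R n).-caratheodory [set z : E | coord_val z k <= x].
Proof.
apply: (@le_caratheodory_measurable _ _ (@lebesgue_outer R n)) => X /=.
apply: le_ereal_inf_tmp => _ [C XC <-].
pose C1 i := ((C i).1, set_coord (C i).2 k (Num.min (coord_val (C i).2 k) x)).
pose C2 i := (set_coord (C i).1 k (Num.max (coord_val (C i).1 k) x), (C i).2).
have -> : (\sum_(i <oo) (box_volume (C i).1 (C i).2)%:E =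
   \sum_(i <oo) (box_volume (C1 i).1 (C1 i).2)%:E +
   \sum_(i <oo) (box_volume (C2 i).1 (C2 i).2)%:E)%E.
  rewrite -nneseriesD; last 2 first.
  - by move=> i _; rewrite lee_fin box_volume_ge0.
  - by move=> i _; rewrite lee_fin box_volume_ge0.
  by apply: eq_eseriesr => i _; rewrite -EFinD box_volume_split.
apply: leeD; apply: le_outer_box_cover => z [Xz zx];
    have [i _ /cboxP zC] := XC _ Xz; exists i => //; apply/cboxP => j /=;
    rewrite coord_of_coords; have := zC j; case: eqP => // ->.
  by rewrite le_min => /andP[-> ->].
by rewrite ge_max => /andP[-> ->]; rewrite andbT/= ltW// ltNge; exact/negP.
Qed.

End coordinates.

(** * Change of variables for monomial affine maps *)

Section monomial_maps.
Variables (R : realType) (n : nat).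
Local Notation E := (spacetime R n).
Local Notation M := (caratheodory_type (@lebesgue_outer R n)).
Implicit Types (s : {perm option 'I_n}) (c d : option 'I_n -> R).

Definition monomial_map s c d (z : E) : E :=
  of_coords (fun k => c k * coord_val z (s k) + d k).

Lemma monomial_mapK s c d : (forall k, c k != 0) ->
  cancel (monomial_map s c d)
    (monomial_map s^-1%g (fun k => (c (s^-1%g k))^-1)
      (fun k => - (c (s^-1%g k))^-1 * d (s^-1%g k))).
Proof.
move=> c0 z; apply: coord_inj => k; rewrite !coord_of_coords permKV.
by rewrite mulrDr mulrA mulVf// mul1r mulNr addrK.
Qed.

(** The preimage of a box is a box: coordinate s k is constrained by side k,
  translated by d k and divided by c k, which exchanges the two bounds when c k
  is negative. *)
Lemma monomial_map_cover s c d (C : nat -> E * E) : (forall k, c k != 0) ->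
  exists C' : nat -> E * E,
    (forall i z, cbox (C i).1 (C i).2 (monomial_map s c d z) ->
       cbox (C' i).1 (C' i).2 z) /\
    (forall i, box_volume (C' i).1 (C' i).2 =
       (\prod_k `|c k|)^-1 * box_volume (C i).1 (C i).2).
Proof.
move=> c0.
(* lo and hi are the sides of the box, exchanged along the reversed axes. *)
pose lo i k := if 0 < c k then coord_val (C i).1 k else coord_val (C i).2 k.
pose hi i k := if 0 < c k then coord_val (C i).2 k else coord_val (C i).1 k.
pose pre (e : nat -> option 'I_n -> R) i : E := of_coords (fun j =>
  let k := s^-1%g j in (e i k - d k) / c k).
exists (fun i => (pre lo i, pre hi i)); split => [i z /cboxP zC|i].
  apply/cboxP => j /=; rewrite !coord_of_coords.
  have := zC (s^-1%g j); rewrite coord_of_coords permKV; set k := s^-1%g j.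
  have [ck|ck|ck] := ltgtP 0 (c k); last by have := c0 k; rewrite -ck eqxx.
  - rewrite /lo /hi ck ler_pdivrMr// ler_pdivlMr// => /andP[h1 h2].
    by apply/andP; split; lra.
  - rewrite /lo /hi (ltNge 0) (ltW ck)/= ler_ndivrMr// ler_ndivlMr//.
    move=> /andP[h1 h2].
    by apply/andP; split; lra.
rewrite !box_volumeE -prodfV -big_split/= (reindex_inj (@perm_inj _ s))/=.
apply: eq_bigr => k _; rewrite !coord_of_coords permK.
have -> : (hi i k - d k) / c k - (lo i k - d k) / c k =
    `|c k|^-1 * (coord_val (C i).2 k - coord_val (C i).1 k).
  rewrite /lo /hi; have [ck|ck|ck] := ltgtP 0 (c k).
  - by rewrite gtr0_norm//; ring.
  - by rewrite ltr0_norm// invrN; ring.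
  - by have := c0 k; rewrite -ck eqxx.
by rewrite maxr_pMr ?mulr0// invr_ge0.
Qed.

Lemma le_outer_preimage_monomial s c d (A : set E) : (forall k, c k != 0) ->
  (lebesgue_outer (monomial_map s c d @^-1` A) <=
   ((\prod_k `|c k|)^-1)%:E * lebesgue_outer A)%E.
Proof.
move=> c0; have p0 : 0 < \prod_k `|c k|.
  by apply: prodr_gt0 => k _; rewrite normr_gt0.
rewrite lee_pdivlMl//; apply: le_ereal_inf_tmp => _ [C AC <-].
rewrite -lee_pdivlMl//.
have [C' [CC' vC']] := monomial_map_cover s d C c0.
rewrite -nneseriesZl//; last by move=> i _; rewrite lee_fin box_volume_ge0.
under eq_eseriesr => i _ do rewrite -EFinM -vC'.
apply: le_outer_box_cover => z /AC[i _ zi].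
by exists i => //; apply: CC'.
Qed.

(** The upper bound of the previous lemma, applied to the inverse map, which is
  again monomial, with inverse factor, gives the lower bound. *)
Lemma outer_preimage_monomial s c d (A : set E) : (forall k, c k != 0) ->
  (lebesgue_outer (monomial_map s c d @^-1` A) =
   ((\prod_k `|c k|)^-1)%:E * lebesgue_outer A)%E.
Proof.
move=> c0; have p0 : 0 < \prod_k `|c k|.
  by apply: prodr_gt0 => k _; rewrite normr_gt0.
apply/eqP; rewrite eq_le le_outer_preimage_monomial//=.
set s' := s^-1%g; set c' := fun k => (c (s' k))^-1.
set d' := fun k => - c' k * d (s' k).
have c'0 k : c' k != 0 by rewrite invr_eq0.
have TK : cancel (monomial_map s' c' d') (monomial_map s c d).
  move=> z; apply: coord_inj => k; rewrite !coord_of_coords.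
  rewrite /c' /d' /c' /s' permK mulrDr !mulrA mulrN.
  by rewrite !divff// mul1r mulN1r subrK.
rewrite lee_pdivrMl//.
have := le_outer_preimage_monomial s' d' (monomial_map s c d @^-1` A) c'0.
rewrite -comp_preimage.
have -> : monomial_map s c d \o monomial_map s' c' d' = id.
  by apply/funext => z /=; rewrite TK.
rewrite preimage_id; congr (_ <= _%:E * _)%E.
rewrite (reindex_inj (@perm_inj _ s))/= -prodfV.
by apply: eq_bigr => k _; rewrite /c' /s' permK normfV invrK.
Qed.

(** Caratheodory's criterion is invariant under a bijection that multiplies the
  outer measure by a constant. *)
Lemma measurable_monomial_map s c d : (forall k, c k != 0) ->
  measurable_fun setT (monomial_map s c d : M -> M).
Proof.
move=> c0 _ A mA; rewrite setTI.
suff : (@lebesgue_outer R n).-caratheodory (monomial_map s c d @^-1` A) by [].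
move=> X.
have TK := monomial_mapK s d c0.
move: TK; set T := monomial_map _ _ _; set S := monomial_map _ _ _ => TK.
have XE : X = T @^-1` (S @^-1` X).
  by apply/seteqP; split => z; rewrite /preimage/= TK.
rewrite [in LHS]XE [in RHS]XE preimage_setC -!preimage_setI.
rewrite !(outer_preimage_monomial s d _ c0).
rewrite -ge0_muleDr ?lebesgue_outer_ge0//; congr (_ * _)%E.
exact: mA.
Qed.

Local Notation mu := (lebesgue_spacetime R n).

(** The image of Lebesgue measure under the map is a multiple of Lebesgue
  measure; the positive and negative parts of f are treated separately. *)
Lemma integral_monomial_map s c d (f : E -> R) : (forall k, c k != 0) ->
  mu.-integrable setT (EFin \o f) ->
  mu.-integrable setT (EFin \o (f \o monomial_map s c d)) /\
  \int[mu]_z f (monomial_map s c d z) =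
    (\prod_k `|c k|)^-1 * \int[mu]_z f z.
Proof.
move=> c0 fi.
have p0 : 0 <= (\prod_k `|c k|)^-1 by rewrite invr_ge0 prodr_ge0.
have mT := measurable_monomial_map s d c0.
have mf := measurable_int _ fi.
pose T : M -> M := monomial_map s c d.
pose K := NngNum p0.
have push (A : set M) :
    measurable A -> A `<=` setT ->
    pushforward mu T A = mscale K mu A.
  by move=> _ _; exact: outer_preimage_monomial.
have ge0E (g : M -> \bar R) : (forall z, 0 <= g z)%E ->
    measurable_fun (setT : set M) g ->
    (\int[mu]_z g (T z) = (K%:num)%:E * \int[mu]_z g z)%E.
  move=> g0 mg.
  rewrite -(ge0_integral_mscale mu measurableT)//.
  rewrite -(@eq_measure_integral _ _ _ _ _ _ g push).
  by rewrite ge0_integral_pushforward.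
have gi : mu.-integrable setT (EFin \o (f \o T)).
  apply/integrableP; split.
    by apply: (measurableT_comp mf).
  have -> := ge0E (fun z => `|(f z)%:E|%E) (fun=> abse_ge0 _).
    by move/integrableP : fi => [_ fi]; rewrite lte_mul_pinfty.
  exact: measurableT_comp.
split=> //.
rewrite /Rintegral.
have -> : (\int[mu]_z (f (monomial_map s c d z))%:E =
  (K%:num)%:E * \int[mu]_z (f z)%:E)%E.
  rewrite integralE [in RHS]integralE.
  have fp := ge0E (EFin \o f)^\+%E (funepos_ge0 _) (measurable_funepos mf).
  have fn := ge0E (EFin \o f)^\-%E (funeneg_ge0 _) (measurable_funeneg mf).
  rewrite muleBr//; last first.
    apply: fin_num_adde_defr; apply: integral_fune_fin_num => //.
    exact: integrable_funepos.
  congr (_ - _)%E; [rewrite -fp|rewrite -fn]; apply: eq_integral => x _.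
    by rewrite !funeposE.
  by rewrite !funenegE.
by rewrite fineM//; exact: integrable_fin_num.
Qed.

End monomial_maps.

(** * Integrals of functions squeezed between integrable ones *)

Section sandwich.
Variables (d : measure_display) (T : measurableType d) (R : realType).
Variable mu : {measure set T -> \bar R}.

(** The integral of a nonnegative function is a supremum over the simple
  functions below it, so it is monotone without any measurability assumption. *)
Lemma le_ge0_integral_nonmeasurable (f g : T -> \bar R) :
  (forall x, 0 <= f x)%E -> (forall x, f x <= g x)%E ->
  (\int[mu]_x f x <= \int[mu]_x g x)%E.
Proof.
move=> f0 fg; have g0 x : (0 <= g x)%E by exact: le_trans (fg x).
rewrite !ge0_integralTE//; apply: le_ereal_sup => _ [h hf <-].
by exists h => // x; exact: le_trans (fg x).
Qed.

Lemma le_integral_nonmeasurable (f g : T -> \bar R) :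
  (forall x, f x <= g x)%E -> (\int[mu]_x f x <= \int[mu]_x g x)%E.
Proof.
move=> fg; rewrite integralE [leRHS]integralE.
apply: leeB; apply: le_ge0_integral_nonmeasurable => x //.
  by rewrite !funeposE ge_max !le_max fg lexx orbT.
by rewrite !funenegE ge_max !le_max leeN2 fg lexx orbT.
Qed.

(** This estimates the integral of f although f may fail to be measurable. *)
Lemma Rintegral_sandwich (f g h : T -> R) :
  mu.-integrable setT (EFin \o g) -> mu.-integrable setT (EFin \o h) ->
  (forall x, `|f x - g x| <= h x) ->
  `|\int[mu]_x f x - \int[mu]_x g x| <= \int[mu]_x h x.
Proof.
move=> gi hi fgh.
have lo : (\int[mu]_x (g x - h x)%:E <= \int[mu]_x (f x)%:E)%E.
  apply: le_integral_nonmeasurable => x; rewrite lee_fin.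
  by have := fgh x; rewrite ler_norml => /andP[? ?]; lra.
have up : (\int[mu]_x (f x)%:E <= \int[mu]_x (g x + h x)%:E)%E.
  apply: le_integral_nonmeasurable => x; rewrite lee_fin.
  by have := fgh x; rewrite ler_norml => /andP[? ?]; lra.
have gF := integrable_fin_num measurableT gi.
have hF := integrable_fin_num measurableT hi.
rewrite (integralB_EFin measurableT gi hi) in lo.
rewrite (integralD_EFin measurableT gi hi) in up.
rewrite /Rintegral; move: gF hF lo up; rewrite /comp.
move: (\int[mu]_x (g x)%:E)%E (\int[mu]_x (h x)%:E)%E (\int[mu]_x (f x)%:E)%E.
move=> [G| |] [H| |] [F| |] //= _ _; rewrite -?EFinB -?EFinD !lee_fin.
by move=> ? ?; rewrite ler_norml; apply/andP; split; lra.
Qed.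

Lemma integrable_Rsum (I : finType) (f : I -> T -> R) :
  (forall i, mu.-integrable setT (EFin \o f i)) ->
  mu.-integrable setT (EFin \o (fun x => \sum_i f i x)).
Proof.
move=> fi; rewrite (_ : _ \o _ = fun x => \sum_i (f i x)%:E)%E.
  by apply: integrable_sum => // i _; exact: fi.
by apply/funext => x /=; rewrite sumEFin.
Qed.

Lemma Rintegral_sum (I : finType) (f : I -> T -> R) :
  (forall i, mu.-integrable setT (EFin \o f i)) ->
  \int[mu]_x (\sum_i f i x) = \sum_i \int[mu]_x f i x.
Proof.
move=> fi; rewrite /Rintegral.
under eq_integral => x _ do rewrite -sumEFin.
rewrite integral_sum// sum_fine// => i _.
exact: (integrable_fin_num measurableT (fi i)).
Qed.

End sandwich.

(** * Moments of a kernel that is radial in space *)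

Section moments.
Variables (R : realType) (n : nat).
Local Notation E := (spacetime R n).
Local Notation M := (caratheodory_type (@lebesgue_outer R n)).
Local Notation mu := (lebesgue_spacetime R n).

Lemma measurable_coord_val k :
  measurable_fun setT ((fun z => coord_val z k) : M -> R).
Proof.
apply: (measurability _ (RGenOInfty.measurableE R)) => _ [_ [x ->] <-].
rewrite setTI.
have -> : (fun z : E => coord_val z k) @^-1` `]x, +oo[ =
    ~` [set z : E | coord_val z k <= x].
  by apply/seteqP; split=> z /=; rewrite in_itv/= andbT ltNge => /negP.
by apply: measurableC; exact: caratheodory_halfspace.
Qed.

Variable J : E -> R.
Hypothesis J_L1 : mu.-integrable setT (EFin \o J).
Variable B : R.
Hypothesis J_supp : forall z, J z != 0 -> forall k, `|coord_val z k| <= B.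

(** J vanishes outside the region where p is bounded by C, so that J p is
  dominated by C J. *)
Lemma integrable_mulJ (p : M -> R) (C : R) : measurable_fun setT p ->
  (forall z, (forall k, `|coord_val z k| <= B) -> `|p z| <= C) ->
  mu.-integrable setT (EFin \o (fun z => J z * p z)).
Proof.
move=> mp pC.
have mJ : measurable_fun setT (J : M -> R).
  exact/measurable_EFinP/(measurable_int _ J_L1).
apply: (@le_integrable _ _ _ mu setT _ _ (EFin \o (fun z => C * J z))).
- exact: measurableT.
- by apply/measurable_EFinP; exact: measurable_funM.
- move=> z _ /=; rewrite lee_fin normrM [C * _]mulrC normrM.
  have [->|Jz] := eqVneq (J z) 0; first by rewrite normr0 !mul0r.
  rewrite ler_wpM2l//; apply: le_trans (ler_norm _); exact/pC/J_supp.
- exact: (integrableZl measurableT C J_L1).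
Qed.

Lemma integrable_J_coord k :
  mu.-integrable setT (EFin \o (fun z => J z * coord_val z k)).
Proof.
apply: (@integrable_mulJ _ B); first exact: measurable_coord_val.
by move=> z; apply.
Qed.

Lemma integrable_J_coord2 k l :
  mu.-integrable setT (EFin \o (fun z => J z * (coord_val z k * coord_val z l))).
Proof.
apply: (@integrable_mulJ _ (B * B)).
  by apply: measurable_funM; exact: measurable_coord_val.
by move=> z zB; rewrite normrM ler_pM.
Qed.

Definition moment1 k : R := \int[mu]_z (J z * coord_val z k).
Definition moment2 k l : R := \int[mu]_z (J z * (coord_val z k * coord_val z l)).

Hypothesis J_radial : forall t : R, radial (fun x => J (x, t)).

Lemma J_enorm (z w : E) : z.2 = w.2 -> enorm z.1 = enorm w.1 -> J z = J w.
Proof.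
case: z w => x t [y u] /= <- xy; have [g gE] := J_radial t.
by rewrite (gE x) (gE y) xy.
Qed.

(** The diagonal matrix of the reflection in the i-th space coordinate. *)
Definition flip (i : 'I_n) (k : option 'I_n) : R := if k == Some i then -1 else 1.

Lemma flip_neq0 i k : flip i k != 0.
Proof. by rewrite /flip; case: ifP => _; rewrite ?oppr_eq0 oner_eq0. Qed.

Lemma integral_flip i (f : E -> R) : mu.-integrable setT (EFin \o f) ->
  \int[mu]_z f (monomial_map 1%g (flip i) (fun=> 0) z) = \int[mu]_z f z.
Proof.
move=> fi; have [_ ->] := integral_monomial_map 1%g (fun=> 0) (flip_neq0 i) fi.
rewrite big1 ?invr1 ?mul1r// => k _.
by rewrite /flip; case: ifP => _; rewrite ?normrN normr1.
Qed.

Lemma coord_flip i z k :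
  coord_val (monomial_map 1%g (flip i) (fun=> 0) z) k = flip i k * coord_val z k.
Proof. by rewrite coord_of_coords perm1 addr0. Qed.

Lemma J_flip i z : J (monomial_map 1%g (flip i) (fun=> 0) z) = J z.
Proof.
apply: J_enorm; first exact: (etrans (coord_flip i z None) (mul1r _)).
congr Num.sqrt; apply: eq_bigr => j _.
have := coord_flip i z (Some j); rewrite /coord_val => ->.
rewrite exprMn /flip; by case: ifP; rewrite ?sqrrN expr1n mul1r.
Qed.

(** The reflection in the i-th coordinate preserves J and changes the sign of
  the integrand. *)
Lemma moment1_space i : moment1 (Some i) = 0.
Proof.
suff : moment1 (Some i) = - moment1 (Some i) by lra.
rewrite {1}/moment1 -(integral_flip i (integrable_J_coord _)).
under eq_Rintegral => z _ do
  rewrite J_flip coord_flip /flip eqxx mulrCA.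
by rewrite RintegralZl ?mulN1r//; exact: integrable_J_coord.
Qed.

Lemma moment2C k l : moment2 k l = moment2 l k.
Proof. by apply: eq_Rintegral => z _; rewrite [coord_val z k * _]mulrC. Qed.

(** One of two distinct coordinates is a space coordinate; reflecting it changes
  the sign of the integrand. *)
Lemma moment2_offdiag k l : k != l -> moment2 k l = 0.
Proof.
(* By symmetry of the moments, k may be taken to be a space coordinate. *)
wlog [i ki] : k l / exists i, k = Some i.
  case: k => [i|] kl ne; first by apply: kl => //; exists i.
  case: l ne => [i|//] _; rewrite moment2C; apply: kl => //; by exists i.
rewrite {k}ki => kl.
suff : moment2 (Some i) l = - moment2 (Some i) l by lra.
rewrite {1}/moment2 -(integral_flip i (integrable_J_coord2 _ _)).
under eq_Rintegral => z _ do
  rewrite J_flip !coord_flip /flip eqxx eq_sym (negbTE kl) mul1r mulN1r mulNr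
    -mulN1r mulrCA.
by rewrite RintegralZl ?mulN1r//; exact: integrable_J_coord2.
Qed.

(** J is invariant under the exchange of two space coordinates. *)
Lemma moment2_diag i j : moment2 (Some i) (Some i) = moment2 (Some j) (Some j).
Proof.
pose s := tperm (Some i) (Some j).
have c0 (k : option 'I_n) : 1 != 0 :> R by rewrite oner_eq0.
have [_ Es] := integral_monomial_map s (fun=> 0) c0
  (integrable_J_coord2 (Some i) (Some i)).
have cs (z : E) k :
    coord_val (monomial_map s (fun=> 1) (fun=> 0) z) k = coord_val z (s k).
  by rewrite coord_of_coords mul1r addr0.
have Js z : J (monomial_map s (fun=> 1) (fun=> 0) z) = J z.
  have sN : s None = None by rewrite tpermD.
  have z2 : (monomial_map s (fun=> 1) (fun=> 0) z).2 = z.2.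
    by have := cs z None; rewrite sN.
  apply: J_enorm => //; congr Num.sqrt.
  have sum2 (w : E) : \sum_k (coord_val w k) ^+ 2 =
     \sum_(k < n) (w.1 0 k) ^+ 2 + w.2 ^+ 2 by rewrite big_option.
  (* The sum of squares over all coordinates, time included, is invariant. *)
  apply: (@addIr _ (z.2 ^+ 2)); rewrite -[in LHS]z2 -!sum2.
  rewrite [RHS](reindex_inj (@perm_inj _ s))/=.
  by apply: eq_bigr => k _; rewrite cs.
move: Es; rewrite big1 ?invr1 ?mul1r => [|k _]; last by rewrite normr1.
rewrite -/(moment2 _ _) => <-; apply: eq_Rintegral => z _.
by rewrite Js !cs tpermL.
Qed.

Lemma moment2_enorm (i0 : 'I_n) :
  \int[mu]_z (enorm z.1 ^+ 2 * J z) = n%:R * moment2 (Some i0) (Some i0).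
Proof.
have e2 (z : E) : enorm z.1 ^+ 2 * J z =
    \sum_i J z * (coord_val z (Some i) * coord_val z (Some i)).
  rewrite sqr_sqrtr ?sumr_ge0// => [|i _]; last exact: sqr_ge0.
  by rewrite mulrC mulr_sumr; apply: eq_bigr => i _; rewrite expr2.
under eq_Rintegral => z _ do rewrite e2.
rewrite Rintegral_sum => [|i]; last exact: integrable_J_coord2.
rewrite (eq_bigr (fun=> moment2 (Some i0) (Some i0))) => [|i _].
  by rewrite sumr_const card_ord mulr_natl.
exact: moment2_diag.
Qed.

End moments.

(** * Second-order Taylor formula *)

Section taylor.
Variable R : realType.

(** One integration of a bound on the derivative.  The mean value theorem gives it
  with the constant C in place of C / (m + 1). *)
Lemma le_pow_MVT (g dg : R -> R) (C : R) (m : nat) :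
  (forall t : R, is_derive t 1 g (dg t)) -> g 0 = 0 -> 0 <= C ->
  (forall t, 0 <= t <= 1 -> `|dg t| <= C * t ^+ m) ->
  forall t, 0 <= t <= 1 -> `|g t| <= C * t ^+ m.+1.
Proof.
move=> dgP g0 C0 dgC t /andP[t0 t1].
have [|c] := @MVT_segment R g dg 0 t t0 (fun x _ => dgP x).
  apply: continuous_subspaceT => x.
  exact/differentiable_continuous/derivable1_diffP.
rewrite in_itv/= => /andP[c0 ct]; rewrite g0 !subr0 => ->.
rewrite normrM (ger0_norm t0) exprSr mulrA ler_wpM2r//.
apply: (le_trans (dgC c _)); first by rewrite c0 (le_trans ct).
by rewrite ler_wpM2l// lerXn2r.
Qed.

(** Three applications of the previous bound to the successive derivatives of
  the remainder. *)
Lemma taylor2_remainder (g g1 g2 g3 : R -> R) (C : R) :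
  (forall t : R, is_derive t 1 g (g1 t)) ->
  (forall t : R, is_derive t 1 g1 (g2 t)) ->
  (forall t : R, is_derive t 1 g2 (g3 t)) ->
  (forall t, `|g3 t| <= C) ->
  `|g 1 - (g 0 + g1 0 + 2^-1 * g2 0)| <= C.
Proof.
move=> dg dg1 dg2 g3C.
have C0 : 0 <= C by exact: le_trans (g3C 0).
(* h is the Taylor remainder, h1 and h2 are its first two derivatives. *)
pose h2 t := g2 t - g2 0.
pose h1 t := g1 t - g1 0 - t * g2 0.
pose h t := g t - g 0 - t * g1 0 - 2^-1 * t ^+ 2 * g2 0.
have dh2 (t : R) : is_derive t 1 h2 (g3 t).
  by apply: is_derive_eq; rewrite subr0.
have dh1 (t : R) : is_derive t 1 h1 (h2 t).
  by apply: is_derive_eq; rewrite /h2 /GRing.scale/=; ring.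
have dh (t : R) : is_derive t 1 h (h1 t).
  by apply: is_derive_eq; rewrite /h1 /GRing.scale/=; field.
have b2 (t : R) : 0 <= t <= 1 -> `|h2 t| <= C * t ^+ 1.
  apply: (le_pow_MVT dh2) => //; first by rewrite /h2 subrr.
  by move=> s _; rewrite expr0 mulr1.
have b1 (t : R) : 0 <= t <= 1 -> `|h1 t| <= C * t ^+ 2.
  by apply: (le_pow_MVT dh1) => //; rewrite /h1 mul0r !subrr.
have /(_ 1) : forall t, 0 <= t <= 1 -> `|h t| <= C * t ^+ 3.
  apply: (le_pow_MVT dh) => //; by rewrite /h expr0n/= mulr0 !mul0r !subrr.
rewrite ler01 lexx expr1n mulr1 => /(_ isT).
by have -> : h 1 = g 1 - (g 0 + g1 0 + 2^-1 * g2 0) by rewrite /h; ring.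
Qed.

Lemma is_derive_fsum (I : finType) (h : I -> R -> R) (dh : I -> R) (t : R) :
  (forall i, is_derive t 1 (h i) (dh i)) ->
  is_derive t 1 (fun s => \sum_i h i s) (\sum_i dh i).
Proof.
move=> hP.
suff : is_derive t 1 (\sum_i h i) (\sum_i dh i).
  by congr is_derive; apply/funext => s; rewrite fct_sumE.
elim/big_ind2 : _ => // [|f df g dg fP gP]; first exact: is_derive_cst.
exact: is_deriveD.
Qed.

Variable n : nat.
Local Notation E := (spacetime R n).

Lemma coord_sum (y : E) : y = \sum_k coord_val y k *: coord_vec R k.
Proof.
rewrite big_option/= [RHS]surjective_pairing; case: y => x t /=.
have raddf_fst (F : 'I_n -> E) : (\sum_i F i).1 = \sum_i (F i).1.
  by elim/big_ind2 : _ => // a b c e <- <-.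
have raddf_snd (F : 'I_n -> E) : (\sum_i F i).2 = \sum_i (F i).2.
  by elim/big_ind2 : _ => // a b c e <- <-.
rewrite raddf_fst raddf_snd /= scaler0 addr0 -row_sum_delta; congr pair.
by rewrite big1 ?add0r /GRing.scale/= ?mulr1// => i _; rewrite mulr0.
Qed.

(** Decomposing y on the coordinate vectors turns the derivative along the line
  into a combination of partial derivatives. *)
Lemma is_derive_line (f : E -> R) (df : option 'I_n -> E -> R) (z y : E) (t : R) :
  (forall w, differentiable f w) ->
  (forall k w, 'D_(coord_vec R k) f w = df k w) ->
  is_derive t 1 (fun s => f (z - s *: y))
    (- \sum_k coord_val y k * df k (z - t *: y)).
Proof.
move=> fd fdf.
pose l (s : R) : E := z - s *: y.
have ld : is_diff t l (fun s => - (s *: y)).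
  by apply: is_diff_eq; apply/funext => s; congr pair; exact: sub0r.
have cd : is_diff t (f \o l) ('d f (l t) \o (fun s => - (s *: y))).
  by apply: is_diff_comp; apply: differentiableP.
apply: DeriveDef; first exact/derivable1_diffP.
rewrite (@deriveE _ _ _ (f \o l)) // diff_val /= scale1r.
rewrite linearN {1}[y]coord_sum linear_sum; congr (- _).
apply: eq_bigr => k _; rewrite linearZ; congr (_ *: _).
by rewrite -deriveE.
Qed.

End taylor.

Section taylor_partials.
Variables (R : realType) (n : nat).
Local Notation E := (spacetime R n).
(* f s plays the role of the iterated partial derivative along s of f [::]. *)
Variable f : seq (option 'I_n) -> E -> R.
Hypothesis f_diff : forall s w, differentiable (f s) w.
Hypothesis f_partial : forall s k w, 'D_(coord_vec R k) (f s) w = f (k :: s) w.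

Lemma norm_coord_sum_le (y : E) (b c : R) (F : option 'I_n -> R) :
  (forall k, `|coord_val y k| <= b) -> (forall k, `|F k| <= c) ->
  `|\sum_k coord_val y k * F k| <= n.+1%:R * b * c.
Proof.
move=> yb Fc; apply: (le_trans (ler_norm_sum _ _ _)).
apply: (@le_trans _ _ (\sum_(k : option 'I_n) b * c)).
  by apply: ler_sum => k _; rewrite normrM ler_pM.
by rewrite sumr_const card_option card_ord -mulrA mulr_natl.
Qed.

Definition taylor2 (z y : E) : R := f [::] z
  - \sum_k coord_val y k * f [:: k] z
  + 2^-1 * \sum_k coord_val y k * \sum_l coord_val y l * f [:: l; k] z.

(** The one-variable formula for t |-> f (z - t y) between 0 and 1, the third
  derivative being a sum of (n + 1)^3 terms. *)
Lemma taylor2_error (z y : E) (a b : R) :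
  (forall k, `|coord_val y k| <= b) ->
  (forall m l k w, `|f [:: m; l; k] w| <= a) ->
  `|f [::] (z - y) - taylor2 z y| <= (n.+1%:R * b) ^+ 3 * a.
Proof.
move=> yb fa; pose c (t : R) : E := z - t *: y.
(* g1, g2 and g3 are the successive derivatives of t |-> f [::] (c t). *)
pose g1 t := - \sum_k coord_val y k * f [:: k] (c t).
pose g2 t := \sum_k coord_val y k * \sum_l coord_val y l * f [:: l; k] (c t).
pose g3 t := - \sum_k coord_val y k * \sum_l coord_val y l *
  \sum_m coord_val y m * f [:: m; l; k] (c t).
have dline s (t : R) : is_derive t (1 : R) (fun t => f s (c t))
    (- \sum_k coord_val y k * f (k :: s) (c t)).
  exact: (is_derive_line z y t (f_diff s) (f_partial s)).
have dsum (F dF : option 'I_n -> R -> R) (t : R) :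
    (forall k, is_derive t (1 : R) (F k) (dF k t)) ->
    is_derive t (1 : R) (fun t => \sum_k coord_val y k * F k t)
      (\sum_k coord_val y k * dF k t).
  by move=> FP; apply: is_derive_fsum => k; exact: is_deriveZ.
have dg1 (t : R) : is_derive t (1 : R) g1 (g2 t).
  rewrite -[g2 t]opprK; apply: is_deriveN; rewrite /g2 -sumrN.
  under eq_bigr do rewrite -mulrN.
  by apply: (dsum _ (fun k t => - \sum_l coord_val y l * f [:: l; k] (c t))).
have dg2 (t : R) : is_derive t (1 : R) g2 (g3 t).
  rewrite /g3 -sumrN; under eq_bigr do rewrite -mulrN -sumrN.
  apply: (dsum _ (fun k t => \sum_l - (coord_val y l *
    \sum_m coord_val y m * f [:: m; l; k] (c t)))) => k.
  under eq_bigr do rewrite -mulrN.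
  by apply: (dsum _ (fun l t => - \sum_m coord_val y m * f [:: m; l; k] (c t))).
have g3C t : `|g3 t| <= (n.+1%:R * b) ^+ 3 * a.
  rewrite normrN !exprS expr0 mulr1 -!mulrA.
  rewrite mulrA; apply: norm_coord_sum_le => // k.
  rewrite mulrA; apply: norm_coord_sum_le => // l.
  by rewrite mulrA; apply: norm_coord_sum_le.
have := taylor2_remainder (dline [::]) dg1 dg2 g3C.
by rewrite /g1 /g2 /c scale1r scale0r subr0.
Qed.

End taylor_partials.

(** * Averages of Taylor polynomials against a dilated kernel *)

Section Rintegral_values.
Variables (d : measure_display) (T : measurableType d) (R : realType).
Variable mu : {measure set T -> \bar R}.

(** Integrability and value are kept together because the rule for the value of
  a linear combination needs the integrability of its terms. *)
Definition has_Rintegral (g : T -> R) (v : R) :=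
  mu.-integrable setT (EFin \o g) /\ \int[mu]_x g x = v.

Lemma has_RintegralD g1 g2 v1 v2 :
  has_Rintegral g1 v1 -> has_Rintegral g2 v2 ->
  has_Rintegral (fun x => g1 x + g2 x) (v1 + v2).
Proof.
move=> [i1 <-] [i2 <-]; split; last exact: RintegralD.
rewrite (_ : _ \o _ = ((EFin \o g1) \+ (EFin \o g2))%E)//.
exact: integrableD.
Qed.

Lemma has_RintegralZ g v c :
  has_Rintegral g v -> has_Rintegral (fun x => c * g x) (c * v).
Proof.
move=> [i <-]; split; last exact: RintegralZl.
rewrite (_ : _ \o _ = (fun x => c%:E * (EFin \o g) x)%E)//.
exact: integrableZl.
Qed.

Lemma has_Rintegral_sum (I : finType) (g : I -> T -> R) (v : I -> R) :
  (forall i, has_Rintegral (g i) (v i)) ->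
  has_Rintegral (fun x => \sum_i g i x) (\sum_i v i).
Proof.
move=> gv; split; first by apply: integrable_Rsum => i; have [] := gv i.
rewrite Rintegral_sum => [|i]; last by have [] := gv i.
by apply: eq_bigr => i _; have [] := gv i.
Qed.

Lemma eq_has_Rintegral g1 g2 v : g1 =1 g2 -> has_Rintegral g1 v ->
  has_Rintegral g2 v.
Proof. by move=> /funext->. Qed.

End Rintegral_values.

Section averaging.
Variables (R : realType) (n : nat).
Local Notation E := (spacetime R n).
Local Notation mu := (lebesgue_spacetime R n).
Variables (J : E -> R) (B : R).
Hypothesis J_ge0 : forall z, 0 <= J z.
Hypothesis J_L1 : mu.-integrable setT (EFin \o J).
Hypothesis J_int1 : \int[mu]_z J z = 1.
Hypothesis J_supp : forall z, J z != 0 -> forall k, `|coord_val z k| <= B.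

Variable f : seq (option 'I_n) -> E -> R.
Hypothesis f_diff : forall s w, differentiable (f s) w.
Hypothesis f_partial : forall s k w, 'D_(coord_vec R k) (f s) w = f (k :: s) w.
Variable a : R.
Hypothesis f_bound : forall m l k w, `|f [:: m; l; k] w| <= a.

Definition parabolic_weight (r : R) (k : option 'I_n) : R :=
  if k is Some _ then r else r ^+ 2.

Lemma parabolic_weight_gt0 r k : 0 < r -> 0 < parabolic_weight r k.
Proof. by case: k => [i|] r0 //=; rewrite exprn_gt0. Qed.

Lemma prod_parabolic_weight r : \prod_k parabolic_weight r k = r ^+ (n + 2).
Proof. by rewrite big_option/= prodr_const card_ord exprD. Qed.

Definition parabolic_scale (r : R) (z : E) : E :=
  of_coords (fun k => parabolic_weight r k * coord_val z k).

Lemma has_Rintegral_taylor2 r z : has_Rintegral mu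
  (fun y => J y * taylor2 f z (parabolic_scale r y))
  (f [::] z - \sum_k parabolic_weight r k * moment1 J k * f [:: k] z +
   2^-1 * \sum_k \sum_l parabolic_weight r k * parabolic_weight r l *
      moment2 J k l * f [:: l; k] z).
Proof.
pose p := parabolic_weight r.
have h0 : has_Rintegral mu (fun y => f [::] z * J y) (f [::] z * 1).
  by apply: has_RintegralZ; split.
have h1 : has_Rintegral mu
    (fun y => \sum_k (p k * f [:: k] z) * (J y * coord_val y k))
    (\sum_k (p k * f [:: k] z) * moment1 J k).
  apply: has_Rintegral_sum => k; apply: has_RintegralZ; split=> //.
  exact: (integrable_J_coord J_L1 J_supp).
have h2 : has_Rintegral mu
    (fun y => \sum_k \sum_l (p k * p l * f [:: l; k] z) *
       (J y * (coord_val y k * coord_val y l)))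
    (\sum_k \sum_l (p k * p l * f [:: l; k] z) * moment2 J k l).
  apply: has_Rintegral_sum => k; apply: has_Rintegral_sum => l.
  apply: has_RintegralZ; split=> //.
  exact: (integrable_J_coord2 J_L1 J_supp).
have := has_RintegralD (has_RintegralD h0 (has_RintegralZ (-1) h1))
  (has_RintegralZ 2^-1 h2).
rewrite mulr1 mulN1r.
under eq_bigr do rewrite mulrAC.
under [X in 2^-1 * X]eq_bigr do under eq_bigr do rewrite mulrAC.
apply: eq_has_Rintegral => y; rewrite /taylor2.
rewrite mulrDr mulrBr mulN1r; congr (_ - _ + _).
- by rewrite mulrC.
- rewrite mulr_sumr; apply: eq_bigr => k _; rewrite coord_of_coords -/p; ring.
- rewrite mulrCA; congr (_ * _); rewrite mulr_sumr; apply: eq_bigr => k _.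
  rewrite coord_of_coords mulr_sumr mulr_sumr; apply: eq_bigr => l _.
  by rewrite coord_of_coords -/p; ring.
Qed.

(** The substitution y = D^-1 (z - w), with D the parabolic scaling by r, is a
  monomial affine map of w; this expresses the kernel and w in terms of y. *)
Lemma parabolic_dilation_changeE r z w : 0 < r ->
  let y := monomial_map 1%g (fun k => - (parabolic_weight r k)^-1)
    (fun k => coord_val z k / parabolic_weight r k) w in
  parabolic_dilation J r (z - w) = (r ^+ (n + 2))^-1 * J y /\
  w = z - parabolic_scale r y.
Proof.
move=> r0 y.
have yE k : coord_val y k =
    (coord_val z k - coord_val w k) / parabolic_weight r k.
  by rewrite coord_of_coords perm1 mulNr addrC mulrBl [coord_val w k / _]mulrC.
split.
  rewrite /parabolic_dilation; congr (_ * J _).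
  apply: coord_inj => k; rewrite yE -coord_valB.
  by case: k => [i|] //=; rewrite mxE mulrC.
apply: coord_inj => k; rewrite coord_valB coord_of_coords yE.
have := parabolic_weight_gt0 k r0 => p0.
by rewrite mulrCA divff ?gt_eqF// mulr1 subKr.
Qed.

(** After the substitution the integrand is J (y) f (z - D y), which differs from
  J (y) times the Taylor polynomial by at most J (y) times the Taylor error.  For
  r <= 1 the coordinates of D y are at most r B on the support of J. *)
Lemma convolution_error r z : 0 < r <= 1 ->
  `|\int[mu]_w (parabolic_dilation J r (z - w) * f [::] w) -
    (f [::] z - \sum_k parabolic_weight r k * moment1 J k * f [:: k] z +
     2^-1 * \sum_k \sum_l parabolic_weight r k * parabolic_weight r l *
       moment2 J k l * f [:: l; k] z)| <= (n.+1%:R * (r * B)) ^+ 3 * a.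
Proof.
move=> /andP[r0 r1].
set v := (X in _ - X); set e := (X in _ <= X).
pose c k := - (parabolic_weight r k)^-1.
pose d k := coord_val z k / parabolic_weight r k.
pose S := monomial_map 1%g c d.
have c0 k : c k != 0.
  by rewrite oppr_eq0 invr_eq0 gt_eqF// parabolic_weight_gt0.
have cE : (\prod_k `|c k|)^-1 = r ^+ (n + 2).
  rewrite -prod_parabolic_weight -prodfV; apply: eq_bigr => k _.
  by rewrite normrN gtr0_norm ?invrK// invr_gt0 parabolic_weight_gt0.
have rn0 : r ^+ (n + 2) != 0 by rewrite gt_eqF// exprn_gt0.
have change g u : has_Rintegral mu g u ->
    has_Rintegral mu (fun w => (r ^+ (n + 2))^-1 * g (S w)) u.
  move=> [gi gu]; have [gSi gSu] := integral_monomial_map 1%g d c0 gi.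
  rewrite -[u](mulKf rn0); apply: has_RintegralZ; split=> //.
  by rewrite gSu cE gu.
have [gi gv] := change _ _ (has_Rintegral_taylor2 r z).
(* The error bound, once integrated against the kernel, is the constant e. *)
have [hi hv] : has_Rintegral mu (fun w => (r ^+ (n + 2))^-1 * (e * J (S w))) e.
  apply: (change (fun y => e * J y)); rewrite -[X in has_Rintegral _ _ X]mulr1.
  by apply: has_RintegralZ; split.
rewrite -/v in gv; rewrite -gv -[leRHS]hv.
apply: Rintegral_sandwich => // w.
have [-> wE] := parabolic_dilation_changeE z w r0.
rewrite -/c -/d -/S in wE *.
have -> : f [::] w = f [::] (z - parabolic_scale r (S w)) by rewrite -wE.
rewrite -mulrA -mulrBr -mulrBr normrM gtr0_norm ?invr_gt0 ?exprn_gt0//.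
rewrite ler_pM2l ?invr_gt0 ?exprn_gt0// normrM ger0_norm// [e * _]mulrC.
have [->|Jy] := eqVneq (J (S w)) 0; first by rewrite !mul0r.
rewrite ler_wpM2l// taylor2_error// => k; rewrite coord_of_coords normrM.
rewrite ler_pM ?J_supp//.
rewrite gtr0_norm ?parabolic_weight_gt0//; case: k => [i|] //=.
by rewrite expr2 ler_piMl// ltW.
Qed.

Hypothesis J_radial : forall t : R, radial (fun x => J (x, t)).
Variable a' : R.
Hypothesis f_bound' : forall w, `|f [:: None; None] w| <= a'.

(** The symmetries of J reduce the averaged Taylor polynomial to the right-hand
  side, up to the contribution in r^4 of the second moment in time. *)
Lemma real_generator_error r z : (0 < n)%N -> 0 < r <= 1 ->
  `|(r ^+ 2)^-1 *
      (\int[mu]_w (parabolic_dilation J r (z - w) * f [::] w) - f [::] z) -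
    (- moment1 J None * f [:: None] z +
     (2 * n%:R)^-1 * \int[mu]_w (enorm w.1 ^+ 2 * J w) *
       \sum_(i < n) f [:: Some i; Some i] z)|
  <= ((n.+1%:R * B) ^+ 3 * a + `|moment2 J None None| * a') * r.
Proof.
move=> n0 r01; set nu := (2 * _)^-1 * _.
have := convolution_error z r01; move/andP: r01 => [r0 r1].
pose i0 := Ordinal n0.
have nuE : nu = 2^-1 * moment2 J (Some i0) (Some i0).
  rewrite /nu (moment2_enorm J_L1 J_supp J_radial i0) invfM -mulrA mulKf//.
  by rewrite pnatr_eq0 -lt0n.
have -> : \sum_k parabolic_weight r k * moment1 J k * f [:: k] z =
    r ^+ 2 * moment1 J None * f [:: None] z.
  rewrite big_option/= big1 ?add0r// => i _.
  by rewrite (moment1_space J_L1 J_supp J_radial) mulr0 mul0r.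
have -> : \sum_k \sum_l parabolic_weight r k * parabolic_weight r l *
      moment2 J k l * f [:: l; k] z =
    r ^+ 2 * moment2 J (Some i0) (Some i0) *
      (\sum_(i < n) f [:: Some i; Some i] z) +
    r ^+ 4 * moment2 J None None * f [:: None; None] z.
  rewrite (eq_bigr (fun k => parabolic_weight r k ^+ 2 * moment2 J k k *
      f [:: k; k] z)) => [|k _].
    rewrite big_option/= -exprM; congr (_ + _); rewrite mulr_sumr.
    by apply: eq_bigr => i _; rewrite (moment2_diag J_L1 J_supp J_radial i i0).
  rewrite (bigD1 k)//= big1 ?addr0 ?expr2// => l lk.
  by rewrite (moment2_offdiag J_L1 J_supp J_radial) 1?eq_sym// mulr0 mul0r.
rewrite nuE; move: (\int[mu]_w _) (\sum_(i < n) _) => I S.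
set m1 := moment1 _ _; set m2 := moment2 _ (Some _) _; set m3 := moment2 _ _ _.
move: (f [::] z) (f [:: None] z) (f_bound' z) => f0 ft.
set ftt := f _ z => fttb; set c := n.+1%:R => err.
have rN0 : r != 0 by rewrite gt_eqF.
set X := (X in `|X| <= _) in err.
have -> : (r ^+ 2)^-1 * (I - f0) - (- m1 * ft + 2^-1 * m2 * S) =
    (r ^+ 2)^-1 * X + r ^+ 2 * (2^-1 * m3 * ftt) by rewrite /X; field.
apply: (le_trans (ler_normD _ _)); rewrite mulrDl; apply: lerD.
  rewrite normrM gtr0_norm ?invr_gt0 ?exprn_gt0// ler_pdivrMl ?exprn_gt0//.
  by rewrite [leRHS](_ : _ = (c * (r * B)) ^+ 3 * a)//; ring.
rewrite normrM (ger0_norm (exprn_ge0 2 (ltW r0))) mulrC.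
apply: ler_pM => //; first exact: exprn_ge0 (ltW r0).
  have h0 : 0 < 2^-1 :> R by rewrite invr_gt0.
  rewrite -mulrA normrM (gtr0_norm h0).
  apply: (@le_trans _ _ `|m3 * ftt|).
    by rewrite ler_piMl// invf_le1// ler1n.
  by rewrite normrM ler_wpM2l.
by rewrite expr2 ler_piMl// ltW.
Qed.

End averaging.

(** * Real and imaginary parts *)

Section complex_parts.
Variables (R : realType) (n : nat).
Local Notation E := (spacetime R n).
Variable phi : E -> Rcomplex R.
Hypothesis phi_smooth : smooth phi.
(* L is meant to be the real or the imaginary part. *)
Variable L : {linear Rcomplex R -> R}.
Hypothesis L_le : forall x, `|L x| <= `|x|.

Lemma part_continuous : continuous L.
Proof.
apply/linear_bounded_continuous/bounded_funP => r; exists r => x.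
exact: le_trans (L_le x).
Qed.

Let f s (w : E) := L (iter_partial s phi w).

Lemma part_differentiable s w : differentiable (f s) w.
Proof.
apply: differentiable_comp => //; apply: linear_differentiable.
exact: part_continuous.
Qed.

Lemma part_partial s k w : 'D_(coord_vec R k) (f s) w = f (k :: s) w.
Proof.
rewrite deriveE; last exact: part_differentiable.
rewrite (@diff_comp _ _ _ _ (iter_partial s phi) L) //=; last first.
  by apply: linear_differentiable; exact: part_continuous.
rewrite diff_lin; last exact: part_continuous.
by rewrite /= -deriveE.
Qed.

End complex_parts.

Lemma norm_Re_le (R : realType) (x : Rcomplex R) : `|complex.Re x| <= `|x|.
Proof.
case: x => u v; rewrite [leRHS]/Num.norm/= -sqrtr_sqr ler_sqrt.
  by rewrite lerDl sqr_ge0.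
by rewrite addr_ge0// sqr_ge0.
Qed.

Lemma norm_Im_le (R : realType) (x : Rcomplex R) : `|complex.Im x| <= `|x|.
Proof.
case: x => u v; rewrite [leRHS]/Num.norm/= -sqrtr_sqr ler_sqrt.
  by rewrite lerDr sqr_ge0.
by rewrite addr_ge0// sqr_ge0.
Qed.

Lemma norm_le_ReIm (R : realType) (x : Rcomplex R) :
  `|x| <= `|complex.Re x| + `|complex.Im x|.
Proof.
case: x => u v; rewrite [leLHS]/Num.norm/=.
rewrite -[leRHS]ger0_norm ?addr_ge0// -sqrtr_sqr ler_sqrt ?sqr_ge0//.
by rewrite sqrrD !real_normK ?num_real// addrAC lerDl mulrn_wge0// mulr_ge0.
Qed.

(** * Bounds from compact support and rapid decay *)

Lemma bounded_closed_support (R : realType) (n : nat) (J : spacetime R n -> R) :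
  compact (closed_support J) ->
  exists B, forall z, J z != 0 -> forall k, `|coord_val z k| <= B.
Proof.
move=> /compact_bounded[C [_ JC]]; exists (C + 1) => z Jz k.
have C1 : C < C + 1 by rewrite ltrDl.
apply: le_trans (JC _ C1 z _); last exact: subset_closure.
rewrite [leRHS]/Num.norm/= le_max.
case: k => [i|] /=; last by rewrite lexx orbT.
apply/orP; left; rewrite [leRHS]/Num.norm/= mx_normrE.
by apply: (le_bigmax _ (fun ij => `|z.1 ij.1 ij.2|) (0, i)).
Qed.

(** The case of a monomial weight of degree 0 in the definition of the Schwartz
  class. *)
Lemma schwartz_partials_bounded (R : realType) (n : nat)
    (phi : spacetime R n -> Rcomplex R) (I : finType)
    (s : I -> seq (option 'I_n)) :
  schwartz phi -> exists a, forall i z, `|iter_partial (s i) phi z| <= a.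
Proof.
move=> [_ phiP].
have /choice[M MP] : forall i, exists M : R, forall z,
    `|iter_partial (s i) phi z| <= M.
  move=> i; have [M MP] := phiP (fun=> 0%N) (s i); exists M => z.
  by have := MP z; rewrite big1 ?scale1r.
exists (\big[Num.max/0]_i M i) => i z.
exact: le_trans (MP i z) (le_bigmax _ _ _).
Qed.

(** * The uniform estimate *)

Section generator_error.
Variables (R : realType) (n : nat) (n_gt0 : (0 < n)%N).
Local Notation E := (spacetime R n).
Local Notation mu := (lebesgue_spacetime R n).
Variables (J : E -> R) (B : R).
Hypothesis J_ge0 : forall z, 0 <= J z.
Hypothesis J_L1 : mu.-integrable setT (EFin \o J).
Hypothesis J_int1 : \int[mu]_z J z = 1.
Hypothesis J_supp : forall z, J z != 0 -> forall k, `|coord_val z k| <= B.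
Hypothesis J_radial : forall t : R, radial (fun x => J (x, t)).
Variable phi : E -> Rcomplex R.
Hypothesis phiS : schwartz phi.

(** The real estimate is applied to the real and to the imaginary part of phi;
  the constants it requires exist because the third derivatives and the second
  time derivative of phi are bounded. *)
Lemma generator_error : exists C, forall r z, 0 < r <= 1 ->
  `|(r ^+ 2)^-1 *: convolution_sub_delta (parabolic_dilation J r) phi z -
    (- moment1 J None *: partial None phi z +
     ((2 * n%:R)^-1 * \int[mu]_w (enorm w.1 ^+ 2 * J w)) *: laplacian phi z)|
  <= C * r.
Proof.
have [smooth_phi _] := phiS.
have [a phia] := schwartz_partials_bounded
  (fun p : option 'I_n * option 'I_n * option 'I_n =>
    [:: p.1.1; p.1.2; p.2]) phiS.
have [b phib] := schwartz_partials_bounded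
  (fun _ : unit => [:: None; None] : seq (option 'I_n)) phiS.
pose C := (n.+1%:R * B) ^+ 3 * a + `|moment2 J None None| * b.
exists (C + C) => r z r01; set nu := (2 * _)^-1 * _.
pose I (L : Rcomplex R -> R) :=
  \int[mu]_w L (parabolic_dilation J r (z - w) *: phi w).
have part (L : {linear Rcomplex R -> R}) : (forall x, `|L x| <= `|x|) ->
    L (convolution (parabolic_dilation J r) phi z) = I L ->
    `|L ((r ^+ 2)^-1 *: convolution_sub_delta (parabolic_dilation J r) phi z -
      (- moment1 J None *: partial None phi z + nu *: laplacian phi z))| <= C * r.
  move=> L1 LI.
  have -> : L ((r ^+ 2)^-1 *:
        convolution_sub_delta (parabolic_dilation J r) phi z -
      (- moment1 J None *: partial None phi z + nu *: laplacian phi z)) =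
      (r ^+ 2)^-1 *
        (\int[mu]_w (parabolic_dilation J r (z - w) * L (phi w)) - L (phi z)) -
      (- moment1 J None * L (partial None phi z) +
        nu * \sum_(i < n) L (partial (Some i) (partial (Some i) phi) z)).
    rewrite linearB; congr (_ - _).
      rewrite linearZ linearB LI; congr (_ * (_ - _)).
      by apply: eq_Rintegral => w _; rewrite linearZ.
    by rewrite linearD !linearZ linear_sum.
  have phia' m l k w : `|L (iter_partial [:: m; l; k] phi w)| <= a.
    exact: le_trans (L1 _) (phia (m, l, k) w).
  have phib' w : `|L (iter_partial [:: None; None] phi w)| <= b.
    exact: le_trans (L1 _) (phib tt w).
  exact: (real_generator_error J_ge0 J_L1 J_int1 J_supp
    (part_differentiable smooth_phi L1) (part_partial smooth_phi L1)
    phia' J_radial phib' z n_gt0 r01).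
apply: (le_trans (norm_le_ReIm _)); rewrite mulrDl; apply: lerD.
  exact: (part (@complex.Re R) (@norm_Re_le R)).
exact: (part (@complex.Im R) (@norm_Im_le R)).
Qed.

End generator_error.

Theorem theorem1 (R : realType) (n : nat) (hn : (0 < n)%N)
    (J : spacetime R n -> R)
    (J_ge0 : forall z, 0 <= J z)
    (J_L1 : (lebesgue_spacetime R n).-integrable setT (fun z => (J z)%:E))
    (J_int1 : (\int[lebesgue_spacetime R n]_z (J z)%:E = 1)%E)
    (J_compact : compact (closed_support J))
    (J_radial : forall t : R, radial (fun x => J (x, t))) :
  let mu : R := - \int[lebesgue_spacetime R n]_z (z.2 * J z) in
  let nu : R :=
    (2 * n%:R)^-1 * \int[lebesgue_spacetime R n]_z (enorm z.1 ^+ 2 * J z) in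
  forall phi : spacetime R n -> Rcomplex R, schwartz phi ->
    {uniform,
      (fun r : R => fun z : spacetime R n =>
        (r ^+ 2)^-1 *: convolution_sub_delta (parabolic_dilation J r) phi z)
        @ 0^'+ -->
      (fun z : spacetime R n =>
        mu *: partial None phi z + nu *: laplacian phi z)}.
Proof.
move=> mu nu phi phiS.
have [B J_supp] := bounded_closed_support J_compact.
have J1 : \int[lebesgue_spacetime R n]_z J z = 1 by rewrite /Rintegral J_int1.
have [C errC] := generator_error hn J_ge0 J_L1 J1 J_supp J_radial phiS.
have muE : mu = - moment1 J None.
  by congr (- _); apply: eq_Rintegral => z _; rewrite mulrC.
move=> P /uniform_nbhs[V [+ VP]]; rewrite -entourage_ballE => -[e /= e0 eV].
have C0 : 0 < `|C| + 1 by rewrite ltr_pwDr.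
near=> r.
have r0 : 0 < r by near: r; exact: nbhs_right_gt.
have r1 : r <= 1 by near: r; exact: nbhs_right_le.
apply: VP => z _; apply: eV; rewrite /= -ball_normE /= distrC muE.
apply: (le_lt_trans (errC r z _)); first by rewrite r0.
apply: (@le_lt_trans _ _ ((`|C| + 1) * r)).
  rewrite ler_pM2r//.
  by rewrite (le_trans (ler_norm C))// lerDl.
rewrite mulrC -ltr_pdivlMr//; near: r.
apply: nbhs_right_lt; exact: divr_gt0.
Unshelve. all: by end_near. Qed.
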